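(* The relation algebra $2_7$ is representable over $\mathbb{Z}/n\mathbb{Z}$ for every even $n\geq 6$, and $\mathrm{CySp}(2_7)=\{2k : k\geq 3\}$ (where $k$ ranges over integers).
   Context: $2_7$ is the finite symmetric integral relation algebra with three atoms $1'$ (identity), $a$, $b$ (all symmetric, i.e. self-converse) whose mandatory diversity cycles (up to equivalence) among $aaa$, $bbb$, $abb$, $baa$ are exactly $aaa$ and $abb$; the others are forbidden. Equivalently its composition is $a;a=1'+a$, $b;b=1'+a$, $a;b=b;a=b$. For a positive integer $n$, a representation of $2_7$ over the cyclic group $\mathbb{Z}/n\mathbb{Z}$ is a partition of $\mathbb{Z}/n\mathbb{Z}$ into $\mathrm{Id}=\{0\}$ and two nonempty sets $A,B$ with $A=-A$, $B=-B$, such that $A+A=A\cup\mathrm{Id}$, $B+B=A\cup\mathrm{Id}$, and $A+B=B$, where $X+Y=\{x+y : x\in X,\ y\in Y\}$ (addition modulo $n$). The algebra is representable over $\mathbb{Z}/n\mathbb{Z}$ if such a partition exists. The cyclic spectrum is $\mathrm{CySp}(2_7)=\{n : n \text{ a positive integer and } 2_7 \text{ is representable over } \mathbb{Z}/n\mathbb{Z}\}$. *)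

(* Defs.v *)
From HB Require Import structures.
From mathcomp Require Import all_boot all_order all_algebra.
From mathcomp Require Import boolp classical_sets.

Set Implicit Arguments.
Unset Strict Implicit.
Unset Printing Implicit Defensive.

Import GRing.Theory.
Local Open Scope ring_scope.

Definition sumset (G : finZmodType) (X Y : {set G}) : {set G} :=
  [set x + y | x in X, y in Y]%SET.

Definition oppset (G : finZmodType) (X : {set G}) : {set G} :=
  [set - x | x in X]%SET.

(* 2_7 is the symmetric integral relation algebra with atoms 1', a, b and
   a;a = 1' + a, b;b = 1' + a, a;b = b. A representation over the abelian group
   G sends 1', a, b to {0}, A, B; the first three fields say that these sets
   form a partition of G. *)
Record representation27 (G : finZmodType) (A B : {set G}) : Prop :=
  Representation27 {
    rep27_nonempty : A != finset.set0 /\ B != finset.set0;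
    rep27_disjoint : [/\ 0 \notin A, 0 \notin B & [disjoint A & B]];
    rep27_cover : 0 |: A :|: B = [set: G]%SET;
    rep27_symA : A = oppset A;
    rep27_symB : B = oppset B;
    rep27_AA : sumset A A = 0 |: A;
    rep27_BB : sumset B B = 0 |: A;
    rep27_AB : sumset A B = B
  }.

(* For n > 0, the type 'I_n.-1.+1 is that of the integers 0, ..., n - 1 with
   addition modulo n; unlike 'Z_n, this is also correct for n = 1. The value
   at n = 0 is junk. *)
Definition representable27 (n : nat) : Prop :=
  exists A B : {set 'I_n.-1.+1}, representation27 A B.

Definition CySp27 : classical_sets.set nat :=
  [set n | (0 < n)%N /\ representable27 n]%classic.

(* Main.v *)
Require Import Defs.
From HB Require Import structures.
From mathcomp Require Import all_boot all_order all_algebra.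
From mathcomp Require Import boolp classical_sets.
From mathcomp Require Import zify.

(** For even [n >= 6], take for [A] the nonzero even residues and for [B] the
    odd ones.

    Conversely, [H = {0} + A] is closed under addition and [B] is a single coset
    of [H], since [B + B] lies in [H] and [H + B] in [B].  As [B] is nonempty,
    [1] is not in [H]; hence [1] is in [B], and by induction the residue of [k]
    lies in [B] exactly when [k] is odd.  Taking [k = n] shows that [n] is even.
    Finally any [a] in [A] is a sum [x + y] in [A + A] with [y <> 0], so [A]
    contains two distinct nonzero even residues, which forces [n >= 6]. *)

Set Implicit Arguments.
Unset Strict Implicit.
Unset Printing Implicit Defensive.

Import GRing.Theory.

Lemma mem_sumset (G : finZmodType) (X Y : {set G}) (x y : G) :
  x \in X -> y \in Y -> (x + y)%R \in sumset X Y.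
Proof. by move=> Xx Yy; apply/imset2P; exists x y. Qed.

Lemma inZpD (m i j : nat) : (@inZp m (i + j) = inZp i + inZp j)%R.
Proof. by apply: val_inj; rewrite /= modnDm. Qed.

(** The modulus [m.+1] is even, so reduction modulo [m.+1] preserves parity. *)
Lemma odd_ordD (m : nat) (x y : 'I_m.+1) :
  odd m -> odd (x + y)%R = odd x (+) odd y.
Proof. by move=> m_odd; rewrite /= odd_mod ?oddD //= m_odd. Qed.

Lemma odd_ordN (m : nat) (x : 'I_m.+1) : odd m -> odd (- x)%R = odd x.
Proof.
move=> m_odd; have := odd_ordD x (- x)%R m_odd.
by rewrite subrr; case: (odd x); case: (odd (- x)%R).
Qed.

Lemma inZp_neq0 (m i : nat) : 0 < i <= m -> @inZp m i != 0%R.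
Proof.
by case/andP=> i_gt0 le_im; rewrite -val_eqE /= modn_small // -lt0n.
Qed.

Lemma representable27_even (n : nat) :
  6 <= n -> ~~ odd n -> representable27 n.
Proof.
case: n => // m; rewrite /representable27 /= negbK => m_ge5 m_odd.
pose A := finset (fun x : 'I_m.+1 => (x != 0%R) && ~~ odd x).
pose B := finset (fun x : 'I_m.+1 => odd x).
have inA x : (x \in A) = (x != 0%R) && ~~ odd x by rewrite inE.
have inB x : (x \in B) = odd x by rewrite inE.
have inH x : (x \in 0%R |: A)%SET = ~~ odd x.
  by rewrite in_setU1 inA; case: eqP => [->|].
pose r k : 'I_m.+1 := inZp k.
have r1 : r 1 \in B by rewrite inB /= modn_small //; lia.
have r2 : r 2 \in A by rewrite inA inZp_neq0 /= ?modn_small //; lia.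
have r4 : r 4 \in A by rewrite inA inZp_neq0 /= ?modn_small //; lia.
have oddB x y : odd (x - y : 'I_m.+1)%R = odd x (+) odd y.
  by rewrite odd_ordD // odd_ordN.
have symA x : (- x \in A)%R = (x \in A) by rewrite !inA oppr_eq0 odd_ordN.
have symB x : (- x \in B)%R = (x \in B) by rewrite !inB odd_ordN.
exists A, B; split.
- by split; apply/set0Pn; [exists (r 2) | exists (r 1)].
- split; rewrite ?inA ?inB ?eqxx //.
  by apply/pred0P => x; rewrite /= inA inB -andbA andNb andbF.
- by apply/setP => x; rewrite finset.in_setU inH inB finset.in_setT orNb.
- apply/setP => x; apply/idP/imsetP => [Ax | [y Ay ->]]; last by rewrite symA.
  by exists (- x)%R; rewrite ?opprK ?symA.
- apply/setP => x; apply/idP/imsetP => [Bx | [y By ->]]; last by rewrite symB.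
  by exists (- x)%R; rewrite ?opprK ?symB.
- apply/setP => x; rewrite inH; apply/imset2P/idP => [[y z] | x_even].
    rewrite !inA => /andP[_ y_even] /andP[_ z_even] ->.
    by rewrite odd_ordD // (negPf y_even) (negPf z_even).
  (* In [x = (x - c) + c] the summand [x - c] must be nonzero to lie in [A], so [c] has to avoid
     [x]. Two distinct candidates, 2 and 4, suffice; both are nonzero residues because [m >= 5]. *)
  have [c Ac x_neq_c] : exists2 c, c \in A & x != c.
    have [->|] := eqVneq x (r 2); last by exists (r 2).
    by exists (r 4); rewrite // -val_eqE /= !modn_small //; lia.
  exists (x - c)%R c; rewrite ?subrK // inA subr_eq0 x_neq_c oddB (negPf x_even).
  by move: Ac; rewrite inA => /andP[].
- apply/setP => x; rewrite inH; apply/imset2P/idP => [[y z] | x_even].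
    by rewrite !inB => y_odd z_odd ->; rewrite odd_ordD // y_odd z_odd.
  exists (x - r 1)%R (r 1); rewrite ?subrK // inB oddB (negPf x_even).
  by rewrite -inB r1.
- apply/setP => x; rewrite inB; apply/imset2P/idP => [[y z] | x_odd].
    rewrite inA inB => /andP[_ y_even] z_odd ->.
    by rewrite odd_ordD // (negPf y_even) z_odd.
  exists (r 2) (x - r 2)%R; [exact: r2 | | by rewrite addrC subrK].
  by move: r2; rewrite inA inB oddB x_odd => /andP[_ /negPf->].
Qed.

(** Adding 1, an element of [B], toggles membership in [B]. Here [k] ranges over all naturals, not
    only those below [m.+1], so that [k = m.+1] may later be compared with the residue 0. *)
Lemma mem_inZp_representation27 (m : nat) (A B : {set 'I_m.+1}) :
  representation27 A B -> forall k, (inZp k \in B) = odd k.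
Proof.
case=> [] [_ B_neq0] [A0 B0 disjAB] cover _ _ AA BB AB.
have cov x : [|| x == 0%R, x \in A | x \in B].
  by have := finset.in_setT x; rewrite -cover !inE orbA.
have notAB x : x \in A -> x \in B = false by move/(disjointFr disjAB).
(* The subgroup [H] is the complement of [B], so the three composition rules can be phrased through
   membership in [B] alone. *)
have HNB x : (x \in 0%R |: A)%SET = (x \notin B).
  rewrite in_setU1; have := cov x; case: eqP => [-> _ | _ /=].
    by rewrite B0.
  by case Ax: (x \in A) => /=; [rewrite notAB | move=> ->].
have addHH x y : x \notin B -> y \notin B -> (x + y)%R \notin B.
  rewrite -!HNB !in_setU1 => /predU1P[-> | Ax]; first by rewrite add0r.
  case/predU1P => [-> | Ay]; first by rewrite addr0 Ax orbT.
  by rewrite -in_setU1 -AA mem_sumset.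
have addHB x y : x \notin B -> y \in B -> (x + y)%R \in B.
  rewrite -HNB in_setU1 => /predU1P[-> | Ax]; first by rewrite add0r.
  by move=> By; rewrite -{1}AB mem_sumset.
have addBB x y : x \in B -> y \in B -> (x + y)%R \notin B.
  by move=> Bx By; rewrite -HNB -BB mem_sumset.
have B_inZp0 : inZp 0 \notin B.
  by rewrite (_ : inZp 0 = 0%R) //; apply: val_inj; rewrite /= mod0n.
(* Otherwise every residue, being a sum of ones, would stay outside [B], and [B] would be empty. *)
have B1 : inZp 1 \in B.
  apply/negPn/negP => B1; case/set0Pn: B_neq0 => x; apply/negP.
  rewrite -(valZpK x); elim: (nat_of_ord x) => [|k IHk] //.
  by rewrite -(addn1 k) inZpD addHH.
elim=> [|k IHk]; first exact: negPf.
rewrite -(addn1 k) inZpD addn1 /= -IHk.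
case Bk: (inZp k \in B); first by rewrite (negPf (addBB _ _ Bk B1)).
by rewrite addHB ?Bk.
Qed.

Lemma representable27_inv (n : nat) :
  0 < n -> representable27 n -> 6 <= n /\ ~~ odd n.
Proof.
case: n => // m _ [A [B repAB]]; rewrite /= in A B repAB *.
have Bodd := mem_inZp_representation27 repAB.
case: repAB => [] [/set0Pn[a Aa] _] [A0 B0 disjAB] _ _ _ AA _ _.
have n_even : ~~ odd m.+1.
  rewrite -Bodd (_ : inZp m.+1 = 0%R) //.
  by apply: val_inj; rewrite /= modnn.
have evenA (x : 'I_m.+1) : x \in A -> ~~ odd x /\ 0 < x.
  move=> Ax; rewrite -Bodd valZpK (disjointFr disjAB Ax) lt0n; split=> //.
  by rewrite (val_eqE x 0%R); apply: contraNneq A0 => <-.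
have : a \in sumset A A by rewrite AA in_setU1 Aa orbT.
case/imset2P => x y Ax Ay def_a.
(* The difference [a - x] is [y], which lies in [A] and hence is nonzero. *)
have a_neq_x : val a != val x.
  rewrite val_eqE def_a -subr_eq0 addrC addKr.
  by apply: contraNneq A0 => <-.
have [[a_even a_gt0] [x_even x_gt0]] := (evenA a Aa, evenA x Ax).
have [lt_an lt_xn] := (ltn_ord a, ltn_ord x).
(* The larger of the two distinct positive even numbers [a] and [x] is at least 4, so the modulus
   exceeds 4; being even, it is at least 6. *)
by move: a_neq_x; rewrite /= => a_neq_x; split=> //; lia.
Qed.

Theorem theorem4 :
  (forall n : nat, (6 <= n)%N -> ~~ odd n -> representable27 n) /\
  CySp27 = [set (2 * k)%N | k in [set k : nat | (3 <= k)%N]]%classic.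
Proof.
split; first exact: representable27_even.
apply/seteqP; split=> [n /= [n_gt0 rep_n] | _ /= [k k_ge3 <-]].
  have [n_ge6 n_even] := representable27_inv n_gt0 rep_n.
  by exists n./2 => /=; lia.
by split; [lia | apply: representable27_even; lia].
Qed.
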